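(* Consider the discrete switched system $\zeta[k+1]=\rho_{\sigma(k)}(\zeta[k])$, $k\in\mathbb{Z}_+$, with a switching signal $\sigma:\mathbb{Z}_+\to\mathcal{P}$, where $\rho_p(\zeta)=\delta_{\rm z}^2\zeta-V_p(\theta^-)$ and the quantities $\delta_{\rm z},V_p,\zeta_{\rm lb}^*,\zeta_{\rm ub}^*,K$ are as defined in the context. Suppose $\zeta_{\rm lb}^*\ge K/\delta_{\rm z}^2$. Then, for any switching signal $\sigma$, the solution of the switched system satisfies $$\zeta_{\rm lb}^*\le\zeta[0]\le\zeta_{\rm ub}^*\ \Longrightarrow\ \zeta_{\rm lb}^*\le\zeta[k]\le\zeta_{\rm ub}^*\quad\text{for all }k\in\mathbb{Z}_+ .$$
   Context: $\mathbb{Z}_+=\{0,1,2,\dots\}$. $\mathcal{P}$ is a finite (nonempty) index set; each $p\in\mathcal{P}$ labels a parameter $\beta_p$ of the feedback controller of a planar biped and a corresponding exponentially stable walking limit cycle. $\theta$ is a scalar phase variable increasing from $\theta^+$ to $\theta^->\theta^+$ during a walking step, and $\zeta\ge0$ is one half of the squared momentum conjugate to the unactuated coordinate, evaluated just before foot impact. On the zero dynamics surface of controller $p$, an impact multiplies $\zeta$ by the constant $\delta_{\rm z}^2$ (the same for all $p$), with $0<\delta_{\rm z}<1$ by exponential stability, and during the following step $\zeta$ as a function of $\theta$ equals its post-impact value minus $V_p(\theta)$, where $V_p:[\theta^+,\theta^-]\to\mathbb{R}$ is a given continuous function with $V_p(\theta^+)=0$. Thus the step-to-step (reduced Poincaré)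 map is $\rho_p(\zeta)=\delta_{\rm z}^2\zeta-V_p(\theta^-)$, whose domain of definition is $\{\zeta:\zeta\ge K_p/\delta_{\rm z}^2\}$, where $K_p=\max_{\theta^+\le\theta\le\theta^-}V_p(\theta)$. The fixed point of $\rho_p$ is $\zeta_p^*=-\frac{V_p(\theta^-)}{1-\delta_{\rm z}^2}$. Define $K=\max_{p\in\mathcal{P}}K_p$, $\zeta_{\rm lb}^*=\min_{p\in\mathcal{P}}\zeta_p^*$, $\zeta_{\rm ub}^*=\max_{p\in\mathcal{P}}\zeta_p^*$. *)

(* Defs.v *)
From mathcomp Require Import all_boot all_order all_algebra.
From mathcomp Require Import all_classical all_reals all_analysis.

Set Implicit Arguments.
Unset Strict Implicit.
Unset Printing Implicit Defensive.

Import Order.TTheory GRing.Theory Num.Theory numFieldNormedType.Exports.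

Local Open Scope classical_set_scope.
Local Open Scope ring_scope.

(* The maxima and minima below are written with [sup] and [inf]; the lemmas
   [Kp_max], [K_max], [zeta_lb_min] and [zeta_ub_max] show that they are attained
   when each [V p] is continuous on [thp, thm] and [P] is nonempty.

   [thp] is theta^+, [thm] is theta^-, and [dz] is delta_z. Only the values of
   [V p] on [thp, thm] are used. *)

Section SwitchedSystem.
Context {R : realType} {P : finType}.
Variables (thp thm dz : R) (V : P -> R -> R).

Definition Kp (p : P) : R := sup (V p @` `[thp, thm]).

Definition K : R := sup (range Kp).

(* [None] encodes that zeta lies outside the domain of definition: the step is
   not completed. *)
Definition rho (p : P) (zeta : R) : option R :=
  if Kp p / dz ^+ 2 <= zeta then Some (dz ^+ 2 * zeta - V p thm) else None.

Definition zeta_star (p : P) : R := - (V p thm / (1 - dz ^+ 2)).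

Definition zeta_lb : R := inf (range zeta_star).

Definition zeta_ub : R := sup (range zeta_star).

(* Once some rho is applied outside its domain, the state stays undefined. *)
Definition is_solution (sigma : nat -> P) (zeta : nat -> option R) : Prop :=
  forall k : nat, zeta k.+1 = obind (rho (sigma k)) (zeta k).

Definition within_bounds (o : option R) : Prop :=
  exists2 z : R, o = Some z & zeta_lb <= z <= zeta_ub.

End SwitchedSystem.

Section Attained.
Context {R : realType}.

Lemma sup_range_max (P : finType) (f : P -> R) : (0 < #|P|)%N ->
  exists2 p, sup (range f) = f p & forall q, f q <= f p.
Proof.
case/card_gt0P => p0 _.
case: (@arg_maxP _ _ _ p0 xpredT f isT) => p _ fp.
exists p => [|q]; last exact: fp.
apply/eqP; rewrite eq_le; apply/andP; split.
  by apply: ge_sup => [|_ [q _ <-]]; [exists (f p0), p0 | exact: fp].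
by apply: ub_le_sup; [exists (f p) => _ [q _ <-]; exact: fp | exists p].
Qed.

Lemma inf_range_min (P : finType) (f : P -> R) : (0 < #|P|)%N ->
  exists2 p, inf (range f) = f p & forall q, f p <= f q.
Proof.
case/card_gt0P => p0 _.
case: (@arg_minP _ _ _ p0 xpredT f isT) => p _ fp.
exists p => [|q]; last exact: fp.
apply/eqP; rewrite eq_le; apply/andP; split.
  by apply: ge_inf; [exists (f p) => _ [q _ <-]; exact: fp | exists p].
by apply: lb_le_inf => [|_ [q _ <-]]; [exists (f p0), p0 | exact: fp].
Qed.

Variables (P : finType) (thp thm dz : R) (V : P -> R -> R).

Lemma Kp_max (p : P) : thp <= thm -> {within `[thp, thm], continuous (V p)} ->
  exists2 c, c \in `[thp, thm] & Kp thp thm V p = V p c /\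
    forall t, t \in `[thp, thm] -> V p t <= V p c.
Proof.
move=> le_th cV; have [c cI Vc] := EVT_max le_th cV.
exists c => //; split=> //; apply/eqP; rewrite eq_le; apply/andP; split.
  by apply: ge_sup => [|_ [t tI <-]]; [exists (V p c), c | exact: Vc].
by apply: ub_le_sup; [exists (V p c) => _ [t tI <-]; exact: Vc | exists c].
Qed.

Lemma K_max : (0 < #|P|)%N -> exists2 p, K thp thm V = Kp thp thm V p &
  forall q, Kp thp thm V q <= Kp thp thm V p.
Proof. exact: sup_range_max. Qed.

Lemma zeta_lb_min : (0 < #|P|)%N ->
  exists2 p, zeta_lb thm dz V = zeta_star thm dz V p &
  forall q, zeta_star thm dz V p <= zeta_star thm dz V q.
Proof. exact: inf_range_min. Qed.

Lemma zeta_ub_max : (0 < #|P|)%N ->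
  exists2 p, zeta_ub thm dz V = zeta_star thm dz V p &
  forall q, zeta_star thm dz V q <= zeta_star thm dz V p.
Proof. exact: sup_range_max. Qed.

End Attained.

(* Main.v *)
Require Import Defs.
From mathcomp Require Import all_boot all_order all_algebra.
From mathcomp Require Import all_classical all_reals all_analysis.
From mathcomp Require Import lra.
Import Order.TTheory GRing.Theory Num.Theory numFieldNormedType.Exports.
Local Open Scope classical_set_scope.
Local Open Scope ring_scope.

(** Since [zeta_star p] is the fixed point of the affine map [rho p], wherever
    that map is defined it reads
      [rho p z = dz ^+ 2 * z + (1 - dz ^+ 2) * zeta_star p],
    and [0 < dz < 1] makes this a convex combination of [z] and [zeta_star p]
    ([step_convexE]). The interval [[zeta_lb, zeta_ub]] contains every fixed
    point and is convex, so it is mapped into itself by every [rho p], whichever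
    controller is selected at each step. The hypothesis on [K] keeps the whole
    interval inside the domain of every [rho p], so no step fails to complete
    ([rho_within_bounds]); the theorem is then an induction on the step number. *)

Lemma step_convexE (R : realType) (P : finType) (thm dz : R) (V : P -> R -> R)
    (p : P) (z : R) : dz ^+ 2 != 1 ->
  dz ^+ 2 * z - V p thm
    = dz ^+ 2 * z + (1 - dz ^+ 2) * zeta_star thm dz V p.
Proof.
move=> dz2_neq1; rewrite /zeta_star mulrN [_ * (_ / _)]mulrC divfK //.
by rewrite subr_eq0 eq_sym.
Qed.

(** The value of [rho p z] stays in the interval by convexity, and is defined
    because [Kp p / dz ^+ 2 <= K / dz ^+ 2 <= zeta_lb <= z]. *)
Lemma rho_within_bounds (R : realType) (P : finType) (thp thm dz : R)
    (V : P -> R -> R) (p : P) (z : R) :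
  0 < dz < 1 -> K thp thm V / dz ^+ 2 <= zeta_lb thm dz V ->
  zeta_lb thm dz V <= z <= zeta_ub thm dz V ->
  within_bounds thm dz V (rho thp thm dz V p z).
Proof.
move=> /andP[dz_gt0 dz_lt1] leK /andP[lbz zub].
have P_gt0 : (0 < #|P|)%N by apply/card_gt0P; exists p.
have dz2_gt0 : 0 < dz ^+ 2 by rewrite exprn_gt0.
have dz2_lt1 : dz ^+ 2 < 1 by rewrite exprn_ilt1 // ltW.
have le_KpK : Kp thp thm V p <= K thp thm V.
  by have [q -> ->] := K_max thp thm V P_gt0.
have lb_star : zeta_lb thm dz V <= zeta_star thm dz V p.
  by have [q -> ->] := zeta_lb_min thm dz V P_gt0.
have star_ub : zeta_star thm dz V p <= zeta_ub thm dz V.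
  by have [q -> ->] := zeta_ub_max thm dz V P_gt0.
have z_dom : Kp thp thm V p / dz ^+ 2 <= z.
  apply: le_trans (le_trans leK lbz).
  by rewrite ler_pM2r ?invr_gt0.
rewrite /rho z_dom; eexists; first by [].
rewrite step_convexE ?lt_eqF //; apply/andP; split; nra.
Qed.

Theorem theorem2 (R : realType) (P : finType) (thp thm dz : R) (V : P -> R -> R)
  (hP : (0 < #|P|)%N)
  (hth : thp < thm)
  (hdz : 0 < dz < 1)
  (hVc : forall p : P, {within `[thp, thm], continuous (V p)})
  (hV0 : forall p : P, V p thp = 0)
  (hK : K thp thm V / dz ^+ 2 <= zeta_lb thm dz V)
  (sigma : nat -> P) (zeta : nat -> option R)
  (hzeta : is_solution thp thm dz V sigma zeta) :
  within_bounds thm dz V (zeta 0%N) ->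
  forall k : nat, within_bounds thm dz V (zeta k).
Proof.
move=> zeta0 k; elim: k => [//|k [z zk z_in]].
by rewrite hzeta zk; exact: rho_within_bounds.
Qed.
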